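(* Let $X=\{X_t,t\ge 0\}$ be a Lévy insurance risk process. Then for all $x\ge 0$, the time of cumulative Parisian ruin $$\sigma_r=\inf\left\{t>0:\int_0^t \mathbf{1}_{(-\infty,0)}(X_s)\,\mathrm{d}s>r\right\}$$ converges $\mathbb{P}_x$-almost surely, as $r\to 0$ ($r>0$), to the time of classical ruin $$\tau_0^-=\inf\{t>0: X_t<0\}.$$
   Context: A Lévy insurance risk process (equivalently, a spectrally negative Lévy process) is a càdlàg process $X=\{X_t,t\ge0\}$ with stationary and independent increments and no positive jumps. $\mathbb{P}_x$ denotes the law of $X$ with initial value $X_0=x$. The convention $\inf\emptyset=\infty$ is used, so both times take values in $[0,\infty]$. *)

(* Defs.v *)
From HB Require Import structures.
From mathcomp Require Import all_boot all_order all_algebra.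
From mathcomp Require Import all_classical all_reals all_analysis.

Set Implicit Arguments.
Unset Strict Implicit.
Unset Printing Implicit Defensive.

Import Order.TTheory GRing.Theory Num.Theory.
Import numFieldTopology.Exports numFieldNormedType.Exports.

Local Open Scope classical_set_scope.
Local Open Scope ring_scope.

(* Time is [0, +oo[.  Processes and paths are indexed by all of R, but every
   notion below only depends on their values at nonnegative times. *)

Definition cadlag (R : realType) (f : R -> R) : Prop :=
  (forall t : R, 0 <= t -> f s @[s --> t^'+] --> f t) /\
  (forall t : R, 0 < t -> cvg (f s @[s --> t^'-])).

Definition no_positive_jumps (R : realType) (f : R -> R) : Prop :=
  forall t : R, 0 < t -> f t <= lim (f s @[s --> t^'-]).

(* Taking some of the B i to be setT gives the product rule for subfamilies. *)
Definition mutually_independent d (T : measurableType d) (R : realType)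
    (P : probability T R) (n : nat) (Y : 'I_n -> T -> R) : Prop :=
  forall B : 'I_n -> set R, (forall i, measurable (B i)) ->
    P [set w | forall i, B i (Y i w)] =
    (\prod_(i < n) P (Y i @^-1` B i))%E.

Definition independent_increments d (T : measurableType d) (R : realType)
    (P : probability T R) (X : R -> T -> R) : Prop :=
  forall (n : nat) (t : nat -> R), 0 <= t 0%N ->
    (forall i : nat, t i <= t i.+1) ->
    mutually_independent P (fun (i : 'I_n) w => X (t i.+1) w - X (t i) w).

Definition stationary_increments d (T : measurableType d) (R : realType)
    (P : probability T R) (X : R -> T -> R) : Prop :=
  forall s t : R, 0 <= s -> s <= t ->
  forall B : set R, measurable B ->
    P [set w | B (X t w - X s w)] = P [set w | B (X (t - s) w - X 0 w)].

(* Path properties are required almost surely, as is customary for Levy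
   processes; this covers processes all of whose paths have them. *)
Record levy_risk_process_from d (T : measurableType d) (R : realType)
    (P : probability T R) (X : R -> T -> R) (x : R) : Prop := {
  levy_measurable : forall t : R, 0 <= t -> measurable_fun [set: T] (X t) ;
  levy_start : {ae P, forall w, X 0 w = x} ;
  levy_cadlag : {ae P, forall w, cadlag (X ^~ w)} ;
  levy_no_pos_jumps : {ae P, forall w, no_positive_jumps (X ^~ w)} ;
  levy_indep : independent_increments P X ;
  levy_stat : stationary_increments P X
}.

(* The second field says that X has under P x the same finite-dimensional
   distributions as x + X under P 0: the family (P x) consists of the laws of
   one and the same process, started from the various points x. *)
Record levy_insurance_risk_process d (T : measurableType d) (R : realType)
    (X : R -> T -> R) (P : R -> probability T R) : Prop := {
  lirp_levy : forall x : R, levy_risk_process_from (P x) X x ;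
  lirp_shift : forall (x : R) (n : nat) (t : 'I_n -> R) (B : 'I_n -> set R),
    (forall i, 0 <= t i) -> (forall i, measurable (B i)) ->
    P x [set w | forall i, B i (X (t i) w)] =
    P 0 [set w | forall i, B i (x + X (t i) w)]
}.

Definition occupation_time_neg (R : realType) (f : R -> R) (t : R) : \bar R :=
  (\int[@lebesgue_measure R]_(s in `[0%R, t])
     (\1_(`]-oo, 0%R[%classic : set R) (f s))%:E)%E.

(* As an infimum in \bar R, this is +oo when the set is empty. *)
Definition cumulative_parisian_ruin (R : realType) (f : R -> R) (r : R)
    : \bar R :=
  ereal_inf [set t%:E | t in [set t : R | 0 < t /\
                                 (r%:E < occupation_time_neg f t)%E]].

Definition classical_ruin (R : realType) (f : R -> R) : \bar R :=
  ereal_inf [set t%:E | t in [set t : R | 0 < t /\ f t < 0]].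

(* Main.v *)
Require Import Defs.
From HB Require Import structures.
From mathcomp Require Import all_boot all_order all_algebra.
From mathcomp Require Import all_classical all_reals all_analysis.
Import Order.TTheory GRing.Theory Num.Theory.
Import numFieldTopology.Exports numFieldNormedType.Exports.
Local Open Scope classical_set_scope.
Local Open Scope ring_scope.

(** The statement is pathwise: it holds for every path [f] that starts at a
    nonnegative level and is right-continuous on [0, +oo[, and almost every path
    of the process is of this kind.

    The time [cumulative_parisian_ruin f r] is nondecreasing in [r], so its
    limit as [r] decreases to 0 is its infimum over [r] in ]0, 1[.  That infimum is
    the classical ruin time.  It is not smaller, because a path can only
    accumulate time below 0 after having gone below 0
    ([classical_ruin_le_parisian]).  It is not larger, because when [f t < 0],
    right-continuity keeps [f] negative on some interval [t, t + e], with [e]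
    as small as desired; the path has then spent at least [e] units of time
    below 0 by time [t + e], and cumulative Parisian ruin at every level below
    [e] has happened by then ([parisian_ruin_near_negative_time]). *)

(** The integral of a nonnegative function is a supremum over the simple
    functions below it, so it is monotone even for functions that are not
    measurable.  This dispenses with showing that the set of times at which a
    path is negative is measurable. *)
Lemma ge0_le_integral_nonmeasurable d (T : measurableType d) (R : realType)
    (mu : {measure set T -> \bar R}) (D : set T) (f g : T -> \bar R) :
  (forall x, D x -> (0 <= f x)%E) -> (forall x, D x -> (f x <= g x)%E) ->
  (\int[mu]_(x in D) f x <= \int[mu]_(x in D) g x)%E.
Proof.
move=> f0 fg; have g0 x : D x -> (0 <= g x)%E.
  by move=> Dx; exact: le_trans (f0 _ Dx) (fg _ Dx).
rewrite !ge0_integralE//; apply: ereal_sup_le => _ [h hf <-].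
exists h => // x; apply: le_trans (hf x) _.
by rewrite !patchE; case: ifPn => //; rewrite inE => /fg.
Qed.

Section path.
Context {R : realType}.
Variable f : R -> R.

Lemma occupation_time_neg_eq0 (t : R) :
  (forall s, 0 <= s <= t -> 0 <= f s) -> occupation_time_neg f t = 0%E.
Proof.
move=> f0; apply: integral0_eq => s /=; rewrite in_itv/= => /f0 fs0.
by rewrite indicE memNset//= in_itv/= ltNge fs0.
Qed.

Lemma occupation_time_neg_ge (t e : R) : 0 <= t -> 0 < e ->
  (forall s, t <= s <= t + e -> f s < 0) ->
  (e%:E <= occupation_time_neg f (t + e))%E.
Proof.
move=> t0 e0 fneg; pose A : set R := [set` `[t, t + e]].
have <- : (\int[@lebesgue_measure R]_(s in `[0%R, (t + e)%R]) (\1_A s)%:E)%E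
    = e%:E.
  rewrite integral_indic; [|exact: measurable_itv..].
  rewrite setIidl; last first.
    move=> s; rewrite /A/= !in_itv/= => /andP[ts ->].
    by rewrite (le_trans t0).
  apply: etrans (lebesgue_measure_itv `[t, t + e]) _.
  by rewrite /= lte_fin ltrDl e0 -EFinB addrAC subrr add0r.
apply: ge0_le_integral_nonmeasurable => s _; rewrite lee_fin//.
rewrite [leLHS]indicE; have [|//] := boolP (s \in A).
by rewrite inE /A/= in_itv/= => /fneg fs; rewrite indicE mem_set//= in_itv/=.
Qed.

Lemma parisian_ruin_nondecreasing :
  {homo cumulative_parisian_ruin f : r s / r <= s >-> (r <= s)%E}.
Proof.
move=> r s rs; apply: le_ereal_inf => _ [t [t0 st] <-].
by exists t => //; split => //; exact: le_lt_trans st.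
Qed.

(** Negative occupation time is positive only if the path is negative somewhere
    on [0, t], and since [0 <= f 0] this happens in ]0, t], the range of times
    that classical ruin looks at. *)
Lemma classical_ruin_le_parisian (r : R) : 0 <= f 0 -> 0 <= r ->
  (classical_ruin f <= cumulative_parisian_ruin f r)%E.
Proof.
move=> f00 r0; apply: le_ereal_inf_tmp => _ [t [t0 rt] <-].
have [[s [s0 st fs]]|nofs] := pselect (exists s, [/\ 0 < s, s <= t & f s < 0]).
  by apply: ereal_inf_le; exists s%:E; [exists s|rewrite lee_fin].
suff occ0 : occupation_time_neg f t = 0%E.
  by move: rt; rewrite occ0 lte_fin ltNge r0.
apply: occupation_time_neg_eq0 => s /andP[].
rewrite le_eqVlt => /predU1P[<-//|s0 st].
by rewrite leNgt; apply/negP => fs; apply: nofs; exists s.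
Qed.

Lemma right_cvg_lt0 (t : R) : f s @[s --> t^'+] --> f t -> f t < 0 ->
  exists2 e : R, 0 < e & forall s, t <= s < t + e -> f s < 0.
Proof.
move=> ft ft0.
have /nbhs_ballP[e /= e0 He] : \forall s \near t, t < s -> f s < 0.
  exact: cvgr_lt ft _ ft0.
exists e => // s /andP[]; rewrite le_eqVlt => /predU1P[<-//|ts ste].
apply: He => //; rewrite /ball/= ltr_distlC; apply/andP; split => //.
by rewrite (lt_trans _ ts)// ltrBlDr ltrDl.
Qed.

Lemma parisian_ruin_near_negative_time (t e : R) : 0 < t -> 0 < e ->
  f s @[s --> t^'+] --> f t -> f t < 0 ->
  exists2 r : R, 0 < r < 1 & (cumulative_parisian_ruin f r <= (t + e)%:E)%E.
Proof.
move=> t0 e0 ft ft0; have [k k0 fk] := right_cvg_lt0 _ ft ft0.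
(* The closed interval [t, t + m] must lie in the half-open interval [t, t + k[,
   hence k / 2; then r = m / 2 is strictly below the time spent under 0. *)
pose m := Num.min 1 (Num.min e (k / 2)).
have m0 : 0 < m by rewrite !lt_min ltr01 e0 divr_gt0.
have mk : m < k by rewrite !gt_min [k / 2 < k]ltr_pdivrMr// ltr_pMr// ltr1n !orbT.
have me : m <= e by rewrite !ge_min lexx orbT.
have m1 : m <= 1 by rewrite ge_min lexx.
have mm : m / 2 < m by rewrite ltr_pdivrMr// ltr_pMr// ltr1n.
exists (m / 2); first by rewrite divr_gt0//= (lt_le_trans mm).
apply: ereal_inf_le; exists (t + m)%:E; last by rewrite lee_fin lerD2l.
exists (t + m) => //; split; first by rewrite addr_gt0.
apply: (@lt_le_trans _ _ m%:E); first by rewrite lte_fin.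
apply: occupation_time_neg_ge => // [|s /andP[ts sm]]; first exact: ltW.
by apply: fk; rewrite ts (le_lt_trans sm)// ltrD2l.
Qed.

Lemma cvg_cumulative_parisian_ruin : 0 <= f 0 ->
  (forall t : R, 0 <= t -> f s @[s --> t^'+] --> f t) ->
  cumulative_parisian_ruin f r @[r --> 0^'+] --> classical_ruin f.
Proof.
move=> f00 fright.
have -> : classical_ruin f =
    ereal_inf (cumulative_parisian_ruin f @` [set` `]0%R, 1%R[]).
  apply/eqP; rewrite eq_le; apply/andP; split.
    apply: le_ereal_inf_tmp => _ [r /= + <-]; rewrite in_itv/= => /andP[r0 _].
    by apply: classical_ruin_le_parisian => //; exact: ltW.
  apply: le_ereal_inf_tmp => _ [t [t0 ft0] <-].
  apply/lee_addgt0Pr => e e0; rewrite -EFinD.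
  have [r r01 rte] :=
    parisian_ruin_near_negative_time _ _ t0 e0 (fright _ (ltW t0)) ft0.
  by apply: ereal_inf_le; exists (cumulative_parisian_ruin f r) => //; exists r.
apply: nondecreasing_at_right_cvge; first by rewrite bnd_simp.
by move=> r s _ _; exact: parisian_ruin_nondecreasing.
Qed.

End path.

Theorem proposition2p3 (R : realType) (d : measure_display)
    (T : measurableType d) (X : R -> T -> R) (P : R -> probability T R)
    (hX : levy_insurance_risk_process X P) (x : R) (hx : 0 <= x) :
  {ae P x, forall w,
     cumulative_parisian_ruin (X ^~ w) r @[r --> 0^'+]
       --> classical_ruin (X ^~ w)}.
Proof.
have [_ start rcll _ _ _] := lirp_levy hX x.
apply: filterS2 start rcll => w Xw0 [Xw_right _].
by apply: cvg_cumulative_parisian_ruin => //; rewrite Xw0.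
Qed.
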